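(* Let $\mathfrak X$ be a homogeneous tree of degree $q+1$ ($q\geq1$). For every integer $k\geq0$, the mean value operator $\mu_k$ satisfies $$\mu_k=\left(\frac{1}{\sqrt q}\right)^k\left[\sqrt q\,\mu_1\,U_{k-1}\!\left(\frac{q+1}{2\sqrt q}\mu_1\right)-U_{k-2}\!\left(\frac{q+1}{2\sqrt q}\mu_1\right)\right].$$
   Context: $\mathfrak X$ is a tree in which every vertex has exactly $q+1$ edges; $d$ is graph distance; $\mathcal F(\mathfrak X)$ is the space of complex-valued functions on its vertices; $S_k(v)=\{w:d(v,w)=k\}$; $\mu_0f=f$ and for $k\geq1$, $\mu_kf(v)=\frac{1}{(q+1)q^{k-1}}\sum_{w\in S_k(v)}f(w)$. $U_n$: Chebyshev polynomials of the second kind, $U_0=1$, $U_1(x)=2x$, $U_n=2xU_{n-1}-U_{n-2}$, with $U_{-n-1}=-U_{n-1}$ for $n\geq0$ (so $U_{-1}=0$, $U_{-2}=-1$); polynomials are applied to the operator $\mu_1$. *)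

(* Defs.v *)
From mathcomp Require Import all_boot all_order all_algebra.
From mathcomp Require Import boolp classical_sets functions cardinality fsbigop.
From mathcomp Require Import reals.
From mathcomp Require Import complex.

Set Implicit Arguments.
Unset Strict Implicit.
Unset Printing Implicit Defensive.

Import Order.TTheory GRing.Theory Num.Theory.
Local Open Scope classical_set_scope.
Local Open Scope ring_scope.
Local Open Scope complex_scope.
Local Open Scope card_scope.

Section Graph.
Variables (V : choiceType) (adj : rel V).

(* The vertex set may be infinite, so the degree is a cardinality of a
   classical set. *)
Record homogeneous_tree (q : nat) : Prop := HomogeneousTree {
  tree_nonempty : [set: V] !=set0;
  tree_irrefl : irreflexive adj;
  tree_sym : symmetric adj;
  tree_connected : forall v w : V, exists p, path adj v p /\ last v p = w;
  tree_acyclic : forall c : seq V, (2 < size c)%N -> uniq c -> ~~ cycle adj c;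
  tree_degree : forall v : V, [set w | adj v w] #= `I_q.+1 }.

Definition walk (v w : V) (n : nat) : Prop :=
  exists p : seq V, [/\ path adj v p, last v p = w & size p = n].

(* The value 0 for vertices not joined by a walk is a dummy, never reached in
   a connected graph. *)
Definition dist (v w : V) : nat :=
  match pselect (exists n, `[< walk v w n >]) with
  | left joined => ex_minn joined
  | right _ => 0%N
  end.

Definition sphere (k : nat) (v : V) : set V := [set w | dist v w = k].

End Graph.

Section Operators.
Variables (R : realType) (V : choiceType).
(* [R[i]^o] is [R[i]] seen as a module over itself; functions and operators
   then inherit their pointwise R[i]-module structures. *)
Local Notation F := (V -> R[i]^o).

(* [\sum_(w \in A)] is 0 when the summand has infinite support in [A]; spheres
   of a homogeneous tree are finite, so these are ordinary sums. *)
Definition mean (adj : rel V) (q k : nat) : F -> F :=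
  if k is j.+1 then
    fun f v => ((q.+1 * q ^ j)%:R)^-1 *: \sum_(w \in sphere adj k v) f w
  else id.

Definition poly_op (p : {poly R[i]}) (T : F -> F) : F -> F :=
  \sum_(i < size p) p`_i *: iter i T.

End Operators.

Section Chebyshev.
Variable K : nzRingType.

Fixpoint chebyU_nat (n : nat) : {poly K} :=
  match n with
  | 0 => 1
  | 1 => 2%:R *: 'X
  | (m.+1 as n').+1 => 2%:R *: 'X * chebyU_nat n' - chebyU_nat m
  end.

(* [Negz n] is -n-1, and U_(-n-1) = - U_(n-1); for n = 0 this forces
   U_(-1) = 0. *)
Definition chebyU (n : int) : {poly K} :=
  match n with
  | Posz n => chebyU_nat n
  | Negz 0 => 0
  | Negz m.+1 => - chebyU_nat m
  end.

End Chebyshev.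

(* Main.v *)
(** In a tree, a vertex [v] at distance [d > 0] from [w] has exactly one
    neighbour at distance [d - 1] from [w], and its [q] other neighbours are at
    distance [d + 1]. Summing over spheres gives
    [(q + 1) mu_1 mu_(k+1) = mu_k + q mu_(k+2)], the Chebyshev recurrence up to
    rescaling by powers of [sqrt q]; the right-hand side of the theorem
    satisfies the same two-term recurrence with the same values at [k = 0] and
    [k = 1]. *)

Require Import Defs.
From HB Require Import structures.
From mathcomp Require Import all_boot all_order all_algebra.
From mathcomp Require Import finmap.
From mathcomp Require Import boolp classical_sets functions cardinality fsbigop.
From mathcomp Require Import reals.
From mathcomp Require Import complex.
From mathcomp Require Import ring zify.

Set Implicit Arguments.
Unset Strict Implicit.
Unset Printing Implicit Defensive.

Import Order.TTheory GRing.Theory Num.Theory.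
Local Open Scope ring_scope.
Local Open Scope complex_scope.

Lemma sumr_seq_const (M : nmodType) (I : Type) (s : seq I) (x : M) :
  \sum_(i <- s) x = x *+ size s.
Proof. by rewrite big_const_seq count_predT iter_addr_0. Qed.

(** * Distances in a tree and the unique neighbour towards a given vertex *)

Section Tree.
Variables (V : choiceType) (adj : rel V) (q : nat).
Hypothesis hT : homogeneous_tree adj q.

Lemma dist_walk (v w : V) : walk adj v w (dist adj v w).
Proof.
rewrite /dist; case: pselect => [joined|[]].
  by case: ex_minnP => n /asboolP.
have [p [vp pw]] := tree_connected hT v w.
by exists (size p); apply/asboolP; exists p.
Qed.

Lemma dist_le (v w : V) (n : nat) : walk adj v w n -> (dist adj v w <= n)%N.
Proof.
move=> vwn; rewrite /dist; case: pselect => // joined.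
by case: ex_minnP => m _; apply; apply/asboolP.
Qed.

Lemma dist_eq0 (v w : V) : (dist adj v w == 0%N) = (v == w).
Proof.
apply/eqP/eqP => [d0|->].
  by have := dist_walk v w; rewrite d0 => -[p [_ + /size0nil p0]]; rewrite p0.
by apply/eqP; rewrite -leqn0; apply: dist_le; exists [::].
Qed.

Lemma walk_cons (v u w : V) (n : nat) :
  adj v u -> walk adj u w n -> walk adj v w n.+1.
Proof.
by move=> vu [p [up pw sp]]; exists (u :: p); rewrite /= vu up sp.
Qed.

Lemma dist_adj_le (v u w : V) :
  adj v u -> (dist adj v w <= (dist adj u w).+1)%N.
Proof. by move=> vu; exact: dist_le (walk_cons vu (dist_walk u w)). Qed.

Lemma dist_eq1 (v w : V) : (dist adj v w == 1%N) = adj v w.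
Proof.
apply/eqP/idP => [d1|vw].
  have := dist_walk v w; rewrite d1 => -[[|u [|? ?]] [//= + uw //]].
  by rewrite -uw andbT.
apply/eqP; rewrite eqn_leq lt0n dist_eq0; apply/andP; split.
  by apply: dist_le; exists [:: w]; rewrite /= vw.
by apply/eqP => vw'; move: vw; rewrite vw' (tree_irrefl hT).
Qed.

Lemma dist_step (v w : V) :
  v != w -> exists2 u, adj v u & dist adj v w = (dist adj u w).+1.
Proof.
have [[|u p] [/= vp pw sp]] := dist_walk v w; first by rewrite pw eqxx.
case/andP: vp => vu up _; exists u => //; apply/eqP.
rewrite eqn_leq dist_adj_le // -sp ltnS.
by apply: dist_le; exists p.
Qed.

(* A closed walk through [v] that visits [v] only once and leaves and enters it
   by different edges would shorten to a cycle. *)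
Lemma branch_unique (v u u' w : V) (p p' : seq V) :
  adj v u -> adj v u' -> path adj u p -> path adj u' p' ->
  last u p = w -> last u' p' = w -> v \notin u :: p -> v \notin u' :: p' ->
  u = u'.
Proof.
move=> vu vu' up up' pw pw' vp vp'; apply: contrapT => /eqP uu'.
(* From [u], [r] follows [p] to [w] and then [p'] backwards to [u'], never meeting [v]. *)
pose r := p ++ rev (belast u' p').
have ur : path adj u r.
  rewrite cat_path up pw -pw' rev_path /=.
  by rewrite (eq_path (e' := adj)) // => x y; exact: (tree_sym hT).
have ru' : last u r = u'.
  rewrite last_cat; move: pw pw'.
  by case: (p') => [|b t] /= <- //; rewrite rev_cons last_rcons.
have vr : v \notin r.
  rewrite mem_cat mem_rev; move: vp vp'.
  rewrite inE negb_or => /andP[_ /negPf->] vp'.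
  by apply: contra vp' => /mem_belast.
move: ru'; case/shortenP: ur => s us s_uniq sr su'.
have := @tree_acyclic _ _ _ hT (v :: u :: s).
have vs : v \notin u :: s.
  rewrite inE negb_or; apply/andP; split.
    by move: vp; rewrite inE negb_or => /andP[].
  by apply: contra vr; exact: sr.
(* An empty [s] would force [u = u']. *)
have s0 : (2 < size (v :: u :: s))%N.
  by case: (s) su' => //= su'; rewrite su' eqxx in uu'.
move=> /(_ s0); rewrite cons_uniq vs s_uniq => /(_ isT) /negP; apply.
by rewrite /= vu rcons_path us su' (tree_sym hT).
Qed.

(** If a geodesic from [u] to [w] met [v], its tail from [v] would already have length at least
    [dist adj u w]; the part before [v] would then be empty and [u = v]. *)
Lemma geodesic_avoids (v u w : V) :
  adj v u -> (dist adj u w <= dist adj v w)%N ->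
  exists p, [/\ path adj u p, last u p = w & v \notin u :: p].
Proof.
move=> vu uvw; have [p [up pw sp]] := dist_walk u w.
have vNu : v != u by apply/eqP => vE; move: vu; rewrite vE (tree_irrefl hT).
exists p; split=> //; apply/negP => vp; move: up pw sp.
case/splitPl: vp => p1 p2 p1v; rewrite cat_path last_cat p1v size_cat.
move=> /andP[_ vp2] p2w sp.
have : (dist adj v w <= size p2)%N by apply: dist_le; exists p2.
move=> /(leq_trans uvw); rewrite -sp -{2}[size p2]add0n leq_add2r leqn0.
by move=> /nilP p10; rewrite -p1v p10 eqxx in vNu.
Qed.

(** The weak inequalities matter: they also exclude a second neighbour at the same distance as [v],
    so every neighbour but the parent is strictly farther from [w]. *)
Lemma parent_unique (v u u' w : V) :
  adj v u -> adj v u' ->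
  (dist adj u w <= dist adj v w)%N -> (dist adj u' w <= dist adj v w)%N ->
  u = u'.
Proof.
move=> vu vu' /(geodesic_avoids vu)[p [up pw vp]].
move=> /(geodesic_avoids vu')[p' [up' pw' vp']].
exact: branch_unique vu vu' up up' pw pw' vp vp'.
Qed.

(** * Finite neighbourhoods and sums over spheres *)

Lemma neighbors (v : V) :
  exists s : seq V, [/\ uniq s, size s = q.+1 & forall u, (u \in s) = adj v u].
Proof.
have d := tree_degree hT v.
have /finite_fsetP[A AE] : finite_set [set w | adj v w]%classic.
  by apply/finite_setP; exists q.+1.
exists (enum_fset A); split; first exact: fset_uniq.
  by apply/card_eq_fsetP; rewrite -AE.
by move=> u; have /(congr1 (@^~ u)) /= := AE => /propeqP[? ?]; apply/idP/idP.
Qed.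

(** By induction: the sphere of radius [k.+1] is covered by the spheres of radius [k] about the
    finitely many neighbours. *)
Lemma sphere_finite (k : nat) (v : V) : finite_set (sphere adj k v).
Proof.
elim: k v => [|k IHk] v.
  apply: (sub_finite_set (B := [set v]%classic)) => // w /eqP.
  by rewrite dist_eq0 => /eqP.
have [s [_ _ sE]] := neighbors v.
apply: (sub_finite_set (B := (\bigcup_(u in [set` s]) sphere adj k u)%classic)).
  move=> w /= vw; have [|u vu] := @dist_step v w.
    by rewrite -dist_eq0 vw.
  by rewrite vw => -[uw]; exists u => //=; rewrite sE.
by apply: bigcup_finite => // u _.
Qed.

(** With [F] supported at a single distance, this counts the neighbours of [v] at that distance from
    [w]. *)
Lemma sum_neighbors_dist (M : nmodType) (F : nat -> M) (v w : V) (s : seq V) :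
  uniq s -> size s = q.+1 -> (forall u, (u \in s) = adj v u) ->
  \sum_(u <- s) F (dist adj u w) =
    if dist adj v w is d.+1 then F d + F d.+2 *+ q else F 1%N *+ q.+1.
Proof.
move=> us ss sE; have [/eqP|] := boolP (dist adj v w == 0%N).
  move=> d0; rewrite d0; move/eqP: d0; rewrite dist_eq0 => /eqP vw.
  rewrite -ss -sumr_seq_const // big_seq [RHS]big_seq.
  apply: eq_bigr => u; rewrite sE => vu; congr F; apply/eqP.
  by rewrite dist_eq1 (tree_sym hT) -vw.
rewrite dist_eq0 => /dist_step[u0 vu0 vw]; rewrite vw.
rewrite (bigD1_seq u0) ?sE //=; congr (_ + _).
rewrite -big_filter big_seq (eq_bigr (fun=> F (dist adj u0 w).+2)).
  rewrite -big_seq sumr_seq_const -rem_filter // size_rem ?sE //.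
  by rewrite ss.
move=> u; rewrite mem_filter sE => /andP[uu0 vu]; congr F.
(* Adjacency gives the upper bound; a neighbour no farther from [w] than [v] would be the parent
   [u0]. *)
apply/eqP; rewrite eqn_leq -{1}vw dist_adj_le 1?(tree_sym hT) //=.
rewrite -vw ltnNge; apply: contra uu0 => uw; apply/eqP.
by apply: parent_unique vu vu0 uw _; rewrite vw.
Qed.

Lemma sphere0 (v : V) : sphere adj 0 v = [set v]%classic.
Proof.
apply/seteqP; split=> w; rewrite /sphere /=.
  by move/eqP; rewrite dist_eq0 => /eqP.
by move=> ->; apply/eqP; rewrite dist_eq0.
Qed.

(** Left unnormalised, so that the recurrence has natural number coefficients. *)
Definition sphere_sum (M : nmodType) (k : nat) (f : V -> M) (v : V) : M :=
  \sum_(w \in sphere adj k v) f w.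

Lemma sphere_sum0 (M : nmodType) (f : V -> M) (v : V) : sphere_sum 0 f v = f v.
Proof. by rewrite /sphere_sum sphere0 fsbig_set1. Qed.

(** Spheres with different centres can thus share one index list, which permits exchanging sums. *)
Lemma sphere_sumE (M : nmodType) (k : nat) (f : V -> M) (v : V) (b : seq V) :
  uniq b -> (sphere adj k v `<=` [set` b])%classic ->
  sphere_sum k f v = \sum_(w <- b) if dist adj v w == k then f w else 0.
Proof.
move=> ub /setIidPr kb; rewrite /sphere_sum -kb fsbig_mkcondr -fsbig_seq //.
apply: eq_bigr => w _; congr (if _ then _ else _).
by apply/idP/eqP; rewrite inE.
Qed.

Lemma sphere_sum1 (M : nmodType) (g : V -> M) (v : V) (s : seq V) :
  uniq s -> (forall u, (u \in s) = adj v u) ->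
  sphere_sum 1 g v = \sum_(u <- s) g u.
Proof.
move=> us sE; rewrite fsbig_seq //; apply: eq_fsbigl.
apply/seteqP; split=> u; rewrite /sphere /= sE -dist_eq1; first by move/eqP.
by move/eqP.
Qed.

Lemma sphere_sum_linear (K : pzRingType) (M : lmodType K) (k : nat) (a : K)
    (f g : V -> M) (v : V) :
  sphere_sum k (a *: f + g) v = a *: sphere_sum k f v + sphere_sum k g v.
Proof.
rewrite /sphere_sum !fsbig_finite; try exact: sphere_finite.
by rewrite scaler_sumr -big_split.
Qed.

(** Each [f w] is counted once per neighbour of [v] at distance [k.+1] from [w]. For [k = 0] and
    [w = v] there is no parent, so all [q.+1] neighbours count. *)
Lemma sphere_sum_rec (M : nmodType) (k : nat) (f : V -> M) (v : V) :
  sphere_sum 1 (sphere_sum k.+1 f) v =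
    sphere_sum k.+2 f v + sphere_sum k f v *+ (if k is 0 then q.+1 else q).
Proof.
have [s [us ss sE]] := neighbors v; rewrite (sphere_sum1 _ us sE).
pose B := ((\bigcup_(u in [set` s]) sphere adj k.+1 u) `|`
  (sphere adj k.+2 v `|` sphere adj k v))%classic.
have /finite_fsetP[b bE] : finite_set B.
  rewrite !finite_setU; split; last by split; exact: sphere_finite.
  by apply: bigcup_finite => // u _; exact: sphere_finite.
have ub := fset_uniq b.
have kb2 : (sphere adj k.+2 v `<=` [set` b])%classic.
  by rewrite -bE => w kw; right; left.
have kb : (sphere adj k v `<=` [set` b])%classic.
  by rewrite -bE => w kw; right; right.
rewrite (sphere_sumE f ub kb2) (sphere_sumE f ub kb).
rewrite (eq_big_seq (fun u =>
    \sum_(w <- b) if dist adj u w == k.+1 then f w else 0)); last first.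
  move=> u su; apply: sphere_sumE => //.
  by rewrite -bE => w kw; left; exists u.
rewrite exchange_big -sumrMnl -big_split; apply: eq_bigr => w _ /=.
rewrite (sum_neighbors_dist (fun d => if d == k.+1 then f w else 0) w us ss sE).
case: (dist adj v w) => [|d] /=.
  by case: k {B bE kb kb2} => [|k] /=; rewrite ?mul0rn ?add0r ?addr0.
rewrite !eqSS; case: k {B bE kb kb2} => [|k]; last by [].
by rewrite mul0rn mul0rn.
Qed.

End Tree.

(** * Chebyshev polynomials and polynomials in a linear operator *)

Lemma chebyU_rec (K : nzRingType) (n : nat) :
  chebyU K n = 'X * (2%:R *: chebyU K (n%:Z - 1)) - chebyU K (n%:Z - 2%:Z).
Proof.
have e2 : 2%:R *: 'X = 'X * 2%:R%:P :> {poly K}.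
  by rewrite -mul_polyC commr_polyX.
case: n => [|[|n]].
(* At [n = 0] the values [U_(-1) = 0] and [U_(-2) = -1] make the recurrence hold. *)
- by rewrite /= scaler0 mulr0 sub0r opprK.
- by rewrite /= subr0 -[_ *: 1]mul_polyC mulr1 e2.
- have -> : (n.+2%:Z - 1 = n.+1%:Z)%R by lia.
  have -> : (n.+2%:Z - 2%:Z = n%:Z)%R by lia.
  by rewrite -[_ *: chebyU _ _]mul_polyC mulrA -e2.
Qed.

Section Operators.
Variables (R : realType) (V : choiceType).
Local Notation F := (V -> R[i]^o).

Lemma poly_op_widen (p : {poly R[i]}) (T : F -> F) (n : nat) :
  (size p <= n)%N -> poly_op p T = \sum_(i < n) p`_i *: iter i T.
Proof.
move=> pn; rewrite /poly_op (big_ord_widen _ (fun i => p`_i *: iter i T) pn).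
rewrite big_mkcond; apply: eq_bigr => i _; case: ltnP => // pi.
by rewrite nth_default // scale0r.
Qed.

Lemma poly_op0 (T : F -> F) : poly_op 0 T = 0.
Proof. by rewrite /poly_op size_poly0 big_ord0. Qed.

Lemma poly_op1 (T : F -> F) : poly_op 1 T = id.
Proof.
rewrite (@poly_op_widen _ _ 1) ?size_poly1 // big_ord1 coef1 scale1r.
exact/funext.
Qed.

Lemma poly_opD (p r : {poly R[i]}) (T : F -> F) :
  poly_op (p + r) T = poly_op p T + poly_op r T.
Proof.
pose n := maxn (size p) (size r).
rewrite !(@poly_op_widen _ _ n) ?leq_maxl ?leq_maxr ?size_polyD //.
by rewrite -big_split; apply: eq_bigr => i _; rewrite coefD scalerDl.
Qed.

Lemma poly_opZ (a : R[i]) (p : {poly R[i]}) (T : F -> F) :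
  poly_op (a *: p) T = a *: poly_op p T.
Proof.
rewrite !(@poly_op_widen _ _ (size p)) ?size_scale_leq // scaler_sumr.
by apply: eq_bigr => i _; rewrite coefZ scalerA.
Qed.

Lemma poly_opB (p r : {poly R[i]}) (T : F -> F) :
  poly_op (p - r) T = poly_op p T - poly_op r T.
Proof. by rewrite poly_opD -scaleN1r poly_opZ scaleN1r. Qed.

(** Linearity lets [T] be pulled out of the sum and past the coefficients. *)
Lemma poly_opMX (p : {poly R[i]}) (T : {linear F -> F}) :
  poly_op ('X * p) T = T \o poly_op p T.
Proof.
rewrite (@poly_op_widen _ _ (size p).+1); last first.
  by rewrite mulrC (leq_trans (size_polyMleq _ _)) // size_polyX addn2.
rewrite big_ord_recl coefXM scale0r add0r; apply/funext => f.
have sumE n (G : 'I_n -> F -> F) : (\sum_(i < n) G i) f = \sum_(i < n) G i f.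
  by rewrite fct_sumE.
rewrite /poly_op sumE [RHS]/= sumE raddf_sum; apply: eq_bigr => i _.
by rewrite coefXM /= !scalrfctE linearZ.
Qed.

Lemma linear_scale (c : R[i]) (T : F -> F) : linear T -> linear (c *: T).
Proof.
move=> linT a f g; change (c *: T (a *: f + g) = a *: (c *: T f) + c *: T g).
by rewrite linT scalerDr !scalerA mulrC.
Qed.

(** * The recurrence for the mean operators *)

Section Mean.
Variables (adj : rel V) (q : nat).
Hypothesis hT : homogeneous_tree adj q.

Lemma mean1_linear : linear (mean (R := R) adj q 1).
Proof.
move=> a f g; apply/funext => v; rewrite /mean !fctE.
rewrite [X in _ *: X](sphere_sum_linear hT) scalerDr !scalerA mulrC.
by congr (_ + _).
Qed.

Lemma mean_rec (hq : (0 < q)%N) (k : nat) (f : F) :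
  mean adj q 1 (mean adj q k.+1 f) =
    q.+1%:R^-1 *: (mean adj q k f + q%:R *: mean adj q k.+2 f).
Proof.
have q0 : (q%:R : R[i]) != 0 by rewrite pnatr_eq0 -lt0n.
have q1 : (q.+1%:R : R[i]) != 0 by rewrite pnatr_eq0.
have meanS j g v : mean adj q j.+1 g v =
  ((q.+1 * q ^ j)%:R)^-1 *: sphere_sum adj j.+1 g v :> R[i]^o by [].
apply/funext => v; rewrite meanS !fctE.
(* The added [0] gives the shape [a *: f + g] of [sphere_sum_linear]. *)
have -> : mean adj q k.+1 f =
    ((q.+1 * q ^ k)%:R)^-1 *: sphere_sum adj k.+1 f + 0.
  by rewrite addr0; apply/funext => w; rewrite meanS.
rewrite (sphere_sum_linear hT) (sphere_sum_rec hT).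
have -> : sphere_sum adj 1 (0 : F) v = 0.
  by rewrite /sphere_sum fsbig1.
rewrite addr0 meanS; case: k => [|k].
  (* Radius 0 is separate: [mean adj q 0] is the identity, and the multiplicity is [q.+1] instead of
     [q]. *)
  rewrite (sphere_sum0 hT) /= /GRing.scale /= !natrM !expn0 !expn1.
  rewrite -[f v *+ q.+1]mulr_natr; move: q0 q1.
  by move: (q.+1%:R) (q%:R) => a b b0 a0; field; rewrite a0 b0.
have qk0 : (q%:R ^+ k : R[i]) != 0 by rewrite expf_neq0.
rewrite meanS /GRing.scale /= !natrM !natrX !exprS.
rewrite -[sphere_sum _ _ _ _ *+ q]mulr_natr; move: q0 q1 qk0.
by move: (q.+1%:R) (q%:R) => a b b0 a0 bk0; field; rewrite a0 b0 bk0.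
Qed.

End Mean.

Lemma poly_op_chebyU (T : F -> F) (c : R[i]) (n : nat) (f : F) : linear T ->
  poly_op (chebyU R[i] n) (c *: T) f =
    (c * 2%:R) *: T (poly_op (chebyU R[i] (n%:Z - 1)) (c *: T) f)
    - poly_op (chebyU R[i] (n%:Z - 2%:Z)) (c *: T) f.
Proof.
move=> linT; have linT' := linear_scale c linT.
pose T' : {linear F -> F} :=
  HB.pack (c *: T) (GRing.isLinear.Build _ _ _ _ _ linT').
rewrite chebyU_rec poly_opB (poly_opMX _ T') poly_opZ.
set p := poly_op _ _; set r := poly_op _ _.
change (c *: T (2%:R *: p f) - r f = (c * 2%:R) *: T (p f) - r f).
by rewrite (scalable_linear linT) scalerA.
Qed.

End Operators.

Theorem theorem6p7 (R : realType) (V : choiceType) (adj : rel V) (q : nat)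
    (hq : (1 <= q)%N) (hT : homogeneous_tree adj q) (k : nat) :
  let sq : R[i] := (Num.sqrt (q%:R : R))%:C in
  let mu : nat -> (V -> R[i]^o) -> (V -> R[i]^o) := mean adj q in
  let U (n : int) : (V -> R[i]^o) -> (V -> R[i]^o) :=
    poly_op (chebyU R[i] n) ((q.+1%:R / (2%:R * sq)) *: mu 1%N) in
  mu k = (1 / sq) ^+ k *:
    (sq *: (mu 1%N \o U (k%:Z - 1)) - U (k%:Z - 2%:Z)).
Proof.
move=> sq mu U.
have sqq : sq ^+ 2 = q%:R.
  by rewrite /sq -rmorphXn /= sqr_sqrtr ?ler0n // rmorph_nat.
have q0 : (q%:R : R[i]) != 0 by rewrite pnatr_eq0 -lt0n.
have q1 : (q.+1%:R : R[i]) != 0 by rewrite pnatr_eq0.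
have sq0 : sq != 0 by move: q0; rewrite -sqq expf_eq0.
have linA : linear (mu 1%N) := mean1_linear hT.
pose A : {linear (V -> R[i]^o) -> (V -> R[i]^o)} :=
  HB.pack (mu 1%N) (GRing.isLinear.Build _ _ _ _ _ linA).
have AE g : mu 1%N g = A g by [].
clearbody A.
have Urec (n : nat) f : U n f =
    (q.+1%:R / sq) *: A (U (n%:Z - 1) f) - U (n%:Z - 2%:Z) f.
  rewrite /U poly_op_chebyU // -/mu -AE; congr (_ *: _ - _).
  by field.
have U0 g : U 0 g = g by rewrite /U poly_op1.
have UN1 g : U (-1) g = 0 by rewrite /U poly_op0.
apply/funext => f.
(* The recurrence has two terms, so the induction carries two consecutive values. *)
suff: mu k f =
    (1 / sq) ^+ k *: (sq *: A (U (k%:Z - 1) f) - U (k%:Z - 2%:Z) f) /\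
  mu k.+1 f = (1 / sq) ^+ k.+1 *: (sq *: A (U k f) - U (k%:Z - 1) f).
  by case=> -> _; rewrite -AE.
elim: k => [|k [IH0 IH1]].
  (* [Urec] at 0 gives [U (-2) f = - f], the value needed for [mu 0]. *)
  have := Urec 0 f; rewrite !sub0r U0 UN1 raddf0 scaler0 sub0r => U2.
  split; first by rewrite expr0 scale1r scaler0 sub0r -U2.
  by rewrite expr1 subr0 scalerA mul1r mulVf // scale1r AE.
have -> : (k.+1%:Z - 1 = k)%R by lia.
have -> : (k.+1%:Z - 2 = k%:Z - 1)%R by lia.
split=> //.
have Hk1 := Urec k.+1 f.
rewrite (_ : (k.+1%:Z - 1 = k)%R) in Hk1; last by lia.
rewrite (_ : (k.+1%:Z - 2 = k%:Z - 1)%R) in Hk1; last by lia.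
have Hk := Urec k f.
have := mean_rec hT hq k f; rewrite -/mu IH0 IH1 AE.
move: (mu k.+2 f) => m; rewrite Hk1 !(linearB, linearZ) /=.
(* Eliminating this term leaves only [U k f], [A (U (k%:Z - 1) f)] and [A (A (U k f))], so a scalar
   identity at each vertex remains. *)
have -> : U (k%:Z - 2%:Z) f = (q.+1%:R / sq) *: A (U (k%:Z - 1) f) - U k f.
  by rewrite Hk subKr.
move: (U k f) (A (U (k%:Z - 1) f)) (A (A (U k f))) => u y x.
move=> mE; apply/funext => v; move/(congr1 (@^~ v)): mE; rewrite !fctE.
rewrite /GRing.scale /= !exprS -sqq.
move: (q.+1%:R) q1 sq0 (_ ^+ k) (m v) => a + + e M.
move: (sq) (x v) (y v) (u v) => s X Y W a0 s0 mE.
(* This solves the mean recurrence for [M]: the factor after [a] is the right side of [mE], whose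
   left side is free of [M]. *)
have -> : M = s ^- 2 * (a * (a^-1 * (s * (e * Y) + e * - (a / s * Y - W)
    + s ^+ 2 * M)) - (s * (e * Y) + e * - (a / s * Y - W))).
  by field; rewrite a0 s0.
by rewrite -mE; field; rewrite s0.
Qed.
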